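(* Let $V=\mathrm{span}_{\mathbb{F}_q}\{x_1,\dots,x_n\}$ and let $\lambda=(\lambda_1\ge\dots\ge\lambda_n\ge0)$ be a partition with at most $n$ nonzero parts. Then $$S_\lambda(V)=(-1)^{|\lambda|}\sum_{\underline V\in\mathcal F}\ \prod_{i=1}^{n}\pi_i(\underline V)^{\frac{q^{\lambda_i}-1}{q-1}},$$ where $\mathcal F$ is the set of all complete flags $\underline V=(V=V_0\supsetneq V_1\supsetneq\dots\supsetneq V_{n-1}\supsetneq V_n=0)$ of $\mathbb{F}_q$-subspaces of $V$, and $\pi_i(\underline V)=\pi(V_{i-1}/V_i)$.
   Context: $q$ is a power of a prime $p$, $S=\mathbb{F}_q[x_1,\dots,x_n]$. For a subspace $W\subset S$ of dimension $k$ with basis $w_1,\dots,w_k$ and strictly decreasing nonnegative integers $\alpha_1>\dots>\alpha_k$, $A_\alpha(W)=\det(w_i^{q^{\alpha_j}})_{1\le i,j\le k}$; for a partition $\lambda$ with at most $k$ nonzero parts, $S_\lambda(W)=A_{\lambda+\delta_k}(W)/A_{\delta_k}(W)\in S$ with $\delta_k=(k-1,\dots,1,0)$ (independent of the basis). $|\lambda|=\sum_i\lambda_i$. For a finite-dimensional subspace $W\subset S$, $\pi(W)$ denotes the product of all nonzero elements of $W$. For subspaces $W\subseteq W'$ of $S$, $f_W(X)=\prod_{w\in W}(X+w)$ is an $\mathbb{F}_q$-linear map $S\to S$ with kernel $W$, and $W'/W:=f_W(W')\subset S$, a subspace of dimension $\dim W'-\dim W$. *)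

(* Defs.v *)
From HB Require Import structures.
From mathcomp Require Import all_boot all_order all_algebra all_field.
From mathcomp Require Import mpoly.
From Stdlib Require Import ClassicalEpsilon.
Set Implicit Arguments. Unset Strict Implicit. Unset Printing Implicit Defensive.
Import GRing.Theory.
Local Open Scope ring_scope.

Section Defs.
Variables (F : finFieldType) (n : nat).

Definition qq : nat := #|F|.

(* Coordinates: v in F^n  <->  sum_i v_i x_i in V = span{x_1..x_n} ⊂ S *)
Definition emb (v : 'rV[F]_n) : {mpoly F[n]} := \sum_(i < n) v ord0 i *: 'X_i.

Definition Amoore (alpha : 'I_n -> nat) : {mpoly F[n]} :=
  \det (\matrix_(i < n, j < n) ('X_i ^+ (qq ^ alpha j)%N)).

Definition delta (j : 'I_n) : nat := (n - 1 - j)%N.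

(* S_lambda(V) = A_{lambda+delta}(V) / A_delta(V), as the (unique, since S is
   a domain and A_delta(V) <> 0) element s of S with s * A_delta = A_{lambda+delta} *)
Definition Slambda (lam : 'I_n -> nat) : {mpoly F[n]} :=
  epsilon (inhabits 0)
    (fun s => s * Amoore delta = Amoore (fun j => (lam j + delta j)%N)).

Definition is_subspace (A : {set 'rV[F]_n}) : bool :=
  (0 \in A) && [forall a : F, forall x in A, forall y in A, a *: x + y \in A].

Definition is_complete_flag (Fl : {ffun 'I_n.+1 -> {set 'rV[F]_n}}) : bool :=
  [forall k, is_subspace (Fl k)] &&
  (Fl ord0 == [set: 'rV[F]_n]) && (Fl ord_max == [set 0]) &&
  [forall k : 'I_n, Fl (inord k.+1) \proper Fl (inord k)].

Definition fW (W : {set 'rV[F]_n}) (X : {mpoly F[n]}) : {mpoly F[n]} :=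
  \prod_(w in W) (X + emb w).

Definition pi_quot (W' W : {set 'rV[F]_n}) : {mpoly F[n]} :=
  \prod_(y <- undup [seq fW W (emb v) | v in W'] | y != 0) y.

Definition pi_flag (Fl : {ffun 'I_n.+1 -> {set 'rV[F]_n}}) (i : 'I_n) :=
  pi_quot (Fl (inord i)) (Fl (inord i.+1)).

End Defs.

(* Main.v *)
Require Import Defs.
From HB Require Import structures.
From mathcomp Require Import all_boot all_order all_fingroup all_algebra all_solvable all_field.
From mathcomp Require Import mpoly zify.
From Stdlib Require ClassicalEpsilon.
Set Implicit Arguments.
Unset Strict Implicit.
Unset Printing Implicit Defensive.
Import GRing.Theory.
Local Open Scope ring_scope.

(* By induction on dim V, it suffices to sum over the hyperplanes H = V_1 of V:
   with v outside H one has pi(V/H) = - f_H(v)^(q-1) and, up to the determinant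
   of a change of basis, A_delta(V) = f_H(v) A_delta(H); so the recursion reads
   A_(lam+delta)(V) = sum_H f_H(v)^(q^lam_1) A_(lam'+delta)(H),
   lam' = (lam_2, lam_3, ...), for bases (v, basis of H) of determinant 1.
   Expanding A_(lam+delta)(V) along its first column reduces this to
   z^(q^(n-1)) = sum_H f_H(z) for z in V, raised to the power q^lam_1.
   If H = ker phi and phi(v) = 1, then f_H(z) = phi(z) f_H(v), and
   f_H(v) = A_delta(V) / B(phi) where B is F_q-linear in phi with the cofactors of
   the first column as coefficients. Hence the last identity is a statement about
   sums of phi_i / B(phi) over phi <> 0, which follows from the vanishing of
   sum_phi B(phi)^(q^s - 1) for s < n (Chevalley-Warning).
   The sums over hyperplanes become minus the sums over phi <> 0, since each H
   arises from q - 1 functionals phi. *)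

(** * Power sums, products and signs over a finite field *)

Section FiniteFieldSums.
Variable F : finFieldType.
Implicit Types a : F.

Lemma expf_card_iter (s : nat) a : a ^+ (#|F| ^ s)%N = a.
Proof.
elim: s => [|s IHs]; first by rewrite expn0 expr1.
by rewrite expnS exprM expf_card.
Qed.

Lemma natr_card : #|F|%:R = 0 :> F.
Proof.
have : \sum_(a : F) a = \sum_(a : F) (a + 1) := reindex_inj (addIr 1).
rewrite big_split /= sumr_const => /eqP.
by rewrite -[X in X == _]addr0 (inj_eq (addrI _)) eq_sym => /eqP.
Qed.

(** The additive group of [F] is an elementary abelian p-group. This is what makes x -> x^q additive
    in [frobD]. *)
Lemma pnat_pchar_card : [pchar F].-nat #|F|.
Proof.
case: (finPcharP F) => p pr_p pF.
have := abelem_pgroup (fin_ring_pchar_abelem pF).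
rewrite /pgroup cardsT; apply: sub_in_pnat => r _.
by rewrite inE => /eqP ->.
Qed.

(** For e = 0 the sum is q = 0. Otherwise X^e - 1 has too few roots to vanish on all nonzero
    elements, and scaling by some b with b^e <> 1 multiplies the sum by b^e. *)
Lemma sum_exp_finField (e : nat) : (e < #|F|.-1)%N -> \sum_(a : F) a ^+ e = 0.
Proof.
case: e => [|e] lt_e.
  rewrite -[RHS]natr_card.
  by rewrite -sumr_const; apply: eq_bigr => a _; rewrite expr0.
have [b b0 be] : exists2 b : F, b != 0 & b ^+ e.+1 != 1.
  apply/exists_inP; rewrite -[X in is_true X]negbK negb_exists_in.
  apply/negP=> /forall_inP all1.
  have p0 : 'X^(e.+1) - 1%:P != 0 :> {poly F}.
    by rewrite -size_poly_eq0 size_XnsubC.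
  have := max_poly_roots p0 (rs := enum (predC1 (0 : F))).
  rewrite size_XnsubC // -cardE cardC1 enum_uniq ltnS leqNgt lt_e.
  have -> : all (root ('X^(e.+1) - 1%:P)) (enum (predC1 (0 : F))).
    apply/allP=> a; rewrite mem_enum inE => a0.
    rewrite rootE !hornerE subr_eq0.
    by have := all1 a a0; rewrite negbK.
  by move=> /(_ isT isT).
have eqS : b ^+ e.+1 * (\sum_(a : F) a ^+ e.+1) = \sum_(a : F) a ^+ e.+1.
  rewrite [RHS](reindex_inj (mulfI b0)) /= mulr_sumr.
  by apply: eq_bigr => a _; rewrite exprMn.
apply/eqP; have /eqP := eqS; rewrite -subr_eq0 -{2}[\sum_(_ | _) _]mul1r -mulrBl.
by rewrite mulf_eq0 subr_eq0 (negPf be).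
Qed.

(** Wilson's theorem, read off at 0 from the factorization of X^q - X after cancelling X. *)
Lemma prod_nonzero_finField : \prod_(a : F | a != 0) a = -1.
Proof.
have eqX : 'X * ('X^(#|F|.-1) - 1) = 'X * \prod_(a : F | a != 0) ('X - a%:P).
  rewrite mulrBr mulr1 -exprS prednK ?finField_genPoly; last first.
    exact: ltnW (finNzRing_gt1 F).
  by rewrite (bigD1 0) //= subr0.
have /(congr1 (horner^~ 0)) := mulfI (negbT (polyX_eq0 F)) eqX.
rewrite !hornerE expr0n -subn1 subn_eq0 leqNgt finNzRing_gt1 /= sub0r => ->.
rewrite horner_prod (reindex_inj oppr_inj) /=.
rewrite (eq_bigl (fun a => a != 0)) => [|a]; last by rewrite oppr_eq0.
by apply: eq_bigr => a _; rewrite !hornerE.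
Qed.

Lemma natr_card_pred : #|F|.-1%:R = -1 :> F.
Proof.
apply/eqP; rewrite -addr_eq0 natr1 prednK ?natr_card //.
exact: ltnW (finNzRing_gt1 F).
Qed.

(** The exponent is 1 + q + ... + q^(s-1), and each (-1)^(q^i) is -1 in [F], also in characteristic
    2. *)
Lemma sign_repunit (s : nat) :
  (-1) ^+ ((#|F| ^ s - 1) %/ (#|F| - 1))%N = (-1) ^+ s :> F.
Proof.
have q1 : (0 < #|F| - 1)%N by rewrite subn_gt0 finNzRing_gt1.
have -> : ((#|F| ^ s - 1) %/ (#|F| - 1) = \sum_(i < s) #|F| ^ i)%N.
  by rewrite !subn1 predn_exp -subn1 mulKn.
elim: s => [|s IHs]; first by rewrite big_ord0.
by rewrite big_ord_recr exprD expf_card_iter exprSr IHs.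
Qed.

End FiniteFieldSums.

(** * Moore determinants and their first-column cofactors *)

Section Moore.
Variables (F : finFieldType) (R : idomainType) (iota : {rmorphism F -> R}).

Definition lincomb m (c : 'rV[F]_m) (z : 'I_m -> R) : R :=
  \sum_(i < m) iota (c 0 i) * z i.

Definition indep m (z : 'I_m -> R) : Prop :=
  forall c : 'rV[F]_m, c != 0 -> lincomb c z != 0.

Lemma frobD (s : nat) : {morph (fun x : R => x ^+ (#|F| ^ s)%N) : x y / x + y}.
Proof.
move=> x y; apply: exprDn_pchar; rewrite pnatX.
apply/orP; left; have := pnat_pchar_card F.
by apply: sub_in_pnat => p _; apply: rmorph_pchar.
Qed.

Lemma frob_neq0 (s : nat) : (#|F| ^ s != 0)%N.
Proof. by rewrite -lt0n expn_gt0 (ltnW (finNzRing_gt1 F)). Qed.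

Lemma frob_sum (s : nat) (I : finType) (P : pred I) (G : I -> R) :
  (\sum_(i | P i) G i) ^+ (#|F| ^ s)%N = \sum_(i | P i) G i ^+ (#|F| ^ s)%N.
Proof.
by apply: (big_morph _ (frobD s)); rewrite expr0n (negPf (frob_neq0 s)).
Qed.

Lemma frob_scalar (s : nat) (a : F) : iota a ^+ (#|F| ^ s)%N = iota a.
Proof. by rewrite -rmorphXn expf_card_iter. Qed.

Lemma lincomb_frob m (c : 'rV[F]_m) (z : 'I_m -> R) (s : nat) :
  lincomb c z ^+ (#|F| ^ s)%N = lincomb c (fun i => z i ^+ (#|F| ^ s)%N).
Proof.
by rewrite frob_sum; apply: eq_bigr => i _; rewrite exprMn frob_scalar.
Qed.

Lemma lincomb0 m (z : 'I_m -> R) : lincomb 0 z = 0.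
Proof. by rewrite /lincomb big1 // => i _; rewrite mxE rmorph0 mul0r. Qed.

Lemma lincombD m (c d : 'rV[F]_m) (z : 'I_m -> R) :
  lincomb (c + d) z = lincomb c z + lincomb d z.
Proof.
by rewrite -big_split; apply: eq_bigr => i _; rewrite mxE rmorphD mulrDl.
Qed.

Lemma lincombN m (c : 'rV[F]_m) (z : 'I_m -> R) :
  lincomb (- c) z = - lincomb c z.
Proof.
by rewrite -sumrN; apply: eq_bigr => i _; rewrite mxE rmorphN mulNr.
Qed.

Lemma lincombZ m (a : F) (c : 'rV[F]_m) (z : 'I_m -> R) :
  lincomb (a *: c) z = iota a * lincomb c z.
Proof.
by rewrite mulr_sumr; apply: eq_bigr => i _; rewrite mxE rmorphM mulrA.
Qed.

Lemma lincomb_mul k m (c : 'rV[F]_k) (B : 'M[F]_(k, m)) (z : 'I_m -> R) :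
  lincomb (c *m B) z = lincomb c (fun i => lincomb (row i B) z).
Proof.
rewrite /lincomb; under [RHS]eq_bigr do rewrite mulr_sumr.
rewrite exchange_big; apply: eq_bigr => j _ /=.
rewrite mxE rmorph_sum mulr_suml; apply: eq_bigr => i _.
by rewrite !mxE rmorphM mulrA.
Qed.

Lemma lincomb_inj m (z : 'I_m -> R) : indep z -> injective (fun c : 'rV[F]_m => lincomb c z).
Proof.
move=> iz c d eq_cd; apply/eqP; rewrite -subr_eq0; apply/negPn/negP => cd.
by have := iz _ cd; rewrite lincombD lincombN eq_cd subrr eqxx.
Qed.

(** Each monomial of the expanded product has degree [#|I|] in the m coordinates of [c], so some
    coordinate has exponent below q - 1; summing over that coordinate gives 0. *)
Lemma sum_prod_lincomb m (I : finType) (z : I -> 'I_m -> R) :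
  (#|I| < m * #|F|.-1)%N ->
  \sum_(c : 'rV[F]_m) \prod_(i : I) lincomb c (z i) = 0.
Proof.
move=> ltI; under eq_bigr do rewrite bigA_distr_bigA.
rewrite exchange_big big1 //= => f _.
under eq_bigr do rewrite big_split /= -rmorph_prod.
rewrite -mulr_suml -rmorph_sum.
suff -> : \sum_(c : 'rV[F]_m) \prod_(i : I) c 0 (f i) = 0.
  by rewrite rmorph0 mul0r.
pose e j := #|[pred i | f i == j]|.
have [j lt_ej] : exists j, (e j < #|F|.-1)%N.
  apply/existsP; rewrite -[X in is_true X]negbK negb_exists.
  apply/negP=> /forallP ge_e; move: ltI; rewrite ltnNge => /negP[].
  rewrite -[#|I|]sum1_card (partition_big f predT) //=.
  rewrite -[X in (X * _)%N]card_ord -sum_nat_const; apply: leq_sum => j _.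
  by rewrite sum1_card leqNgt ge_e.
transitivity (\sum_(g : {ffun 'I_m -> F}) \prod_(j < m) g j ^+ e j).
  rewrite (reindex (fun g : {ffun 'I_m -> F} => \row_j g j)) /=; last first.
    exists (fun c : 'rV[F]_m => [ffun j => c 0 j]) => [g|c] _.
      by apply/ffunP=> k; rewrite ffunE mxE.
    by apply/rowP=> k; rewrite mxE ffunE.
  apply: eq_bigr => g _; rewrite (partition_big f predT) //=.
  apply: eq_bigr => k _; rewrite -prodr_const; apply: eq_bigr => i /eqP <-.
  by rewrite mxE.
rewrite -(bigA_distr_bigA (fun j a => a ^+ e j)).
by rewrite (bigD1 j) //= sum_exp_finField // mul0r.
Qed.

(* Chevalley-Warning: [lincomb c z ^+ (q^s - 1)] has degree [s(q-1)] in [c],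
   because the Frobenius powers of [lincomb c z] are linear in [c]. *)
Lemma sum_lincomb_pow m (z : 'I_m -> R) (s : nat) : (s < m)%N ->
  \sum_(c : 'rV[F]_m) lincomb c z ^+ (#|F| ^ s).-1 = 0.
Proof.
move=> lt_sm.
have := @sum_prod_lincomb m ('I_s * 'I_(#|F|.-1))%type
  (fun p i => z i ^+ (#|F| ^ p.1)%N).
rewrite card_prod !card_ord ltn_pmul2r => [/(_ lt_sm) eq0|]; last first.
  by rewrite -subn1 subn_gt0 finNzRing_gt1.
rewrite -[RHS]eq0; apply: eq_bigr => c _.
rewrite predn_exp mulnC exprM -prodrXr.
rewrite -(pair_big predT predT (fun (t : 'I_s) (u : 'I_(#|F|.-1)) =>
  lincomb c (fun i => z i ^+ (#|F| ^ t)%N))) /= -prodrXl.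
by apply: eq_bigr => t _; rewrite prodr_const card_ord lincomb_frob.
Qed.


(* The shift [delta] is built in: column [j] has exponent
   [q ^ (lam j + delta j)], so that [moore lam] is [A_(lam + delta)]. *)
Definition moore m (lam : nat -> nat) (z : 'I_m -> R) : R :=
  \det (\matrix_(i < m, j < m) z i ^+ (#|F| ^ (lam j + (m - 1 - j)))%N).

Definition moore_col m (t : 'I_m.+1 -> R) (lam : nat -> nat)
    (z : 'I_m.+1 -> R) : 'M[R]_m.+1 :=
  \matrix_(i, j) if j == ord0 then t i
                 else z i ^+ (#|F| ^ (lam j + (m.+1 - 1 - j)))%N.

(** These cofactors do not see the first column, so 0 is a mere placeholder there. With [lam] zero,
    [lincomb phi] of them is the form B(phi). *)
Definition moore_cof m (lam : nat -> nat) (z : 'I_m.+1 -> R) (i : 'I_m.+1) : R :=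
  cofactor (moore_col (fun=> 0) lam z) i ord0.

Lemma det_moore_col m (t : 'I_m.+1 -> R) (lam : nat -> nat) (z : 'I_m.+1 -> R) :
  \det (moore_col t lam z) = \sum_i t i * moore_cof lam z i.
Proof.
rewrite (expand_det_col _ ord0); apply: eq_bigr => i _.
rewrite mxE eqxx; congr (_ * (_ * \det _)).
by apply/matrixP=> a b; rewrite !mxE eq_sym (negPf (neq_lift _ _)).
Qed.

Lemma moore_expand m (lam : nat -> nat) (z : 'I_m.+1 -> R) :
  moore lam z = \sum_i z i ^+ (#|F| ^ (lam 0 + m))%N * moore_cof lam z i.
Proof.
rewrite -det_moore_col; congr (\det _); apply/matrixP=> i j; rewrite !mxE.
by case: eqP => [->|//]; rewrite /= subn0 subn1.
Qed.

Lemma moore_mulmx m (P : 'M[F]_m) (lam : nat -> nat) (z : 'I_m -> R) :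
  moore lam (fun i => lincomb (row i P) z) = iota (\det P) * moore lam z.
Proof.
rewrite -det_map_mx -det_mulmx; congr (\det _); apply/matrixP=> i j.
by rewrite !mxE lincomb_frob; apply: eq_bigr => l _; rewrite !mxE.
Qed.

(** Put [phi] in the first column. Multiplication by [P] turns it into e_0, so expanding along it
    leaves the Moore determinant of the last m rows of [P], which lie in ker phi. *)
Lemma moore_cof_basis m (P : 'M[F]_m.+1) (phi : 'rV[F]_m.+1)
    (lam : nat -> nat) (z : 'I_m.+1 -> R) :
  P *m phi^T = delta_mx ord0 ord0 ->
  iota (\det P) * lincomb phi (moore_cof lam z) =
  moore (fun j => lam j.+1) (fun i => lincomb (row (lift ord0 i) P) z).
Proof.
move=> Pphi; rewrite /lincomb -det_moore_col -det_map_mx -det_mulmx.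
rewrite (expand_det_col _ ord0) (bigD1 ord0) //= big1 => [|i i0].
  rewrite addr0; have -> : (map_mx iota P *m
      moore_col (fun i => iota (phi 0 i)) lam z) ord0 ord0 = 1.
    transitivity (iota ((P *m phi^T) ord0 ord0)); last first.
      by rewrite Pphi mxE eqxx rmorph1.
    rewrite !mxE rmorph_sum; apply: eq_bigr => l _.
    by rewrite !mxE eqxx rmorphM.
  rewrite mul1r /cofactor addn0 expr0 mul1r; congr (\det _).
  apply/matrixP=> i j; rewrite !mxE lincomb_frob.
  apply: eq_bigr => l _; rewrite !mxE eq_sym (negPf (neq_lift _ _)).
  congr (_ * _ ^+ (_ ^ (_ + _))%N); rewrite /= /bump /=; lia.
suff -> : (map_mx iota P *m
    moore_col (fun i => iota (phi 0 i)) lam z) i ord0 = 0 by rewrite mul0r.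
transitivity (iota ((P *m phi^T) i ord0)); last first.
  by rewrite Pphi mxE (negPf i0) rmorph0.
rewrite !mxE rmorph_sum; apply: eq_bigr => l _.
by rewrite !mxE eqxx rmorphM.
Qed.

Definition cons_fun m (x : R) (h : 'I_m -> R) (i : 'I_m.+1) : R :=
  if unlift ord0 i is Some j then h j else x.

(* As a polynomial in [x], the determinant has degree [q^k] and vanishes at the
   [q^k] linear combinations of [h]. *)
Lemma moore_cons k (x : R) (h : 'I_k -> R) : injective (fun c : 'rV[F]_k => lincomb c h) ->
  moore (fun=> 0%N) (cons_fun x h) =
  moore (fun=> 0%N) h * \prod_(c : 'rV[F]_k) (x + lincomb c h).
Proof.
move=> inj_h.
pose cof j := cofactor (\matrix_(i < k.+1, j < k.+1)
  cons_fun 0 h i ^+ (#|F| ^ (0 + (k.+1 - 1 - j)))%N) ord0 j.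
pose p : {poly R} := \sum_(j < k.+1) (cof j)%:P * 'X^(#|F| ^ (k - j))%N.
have pE y : p.[y] = moore (fun=> 0%N) (cons_fun y h).
  rewrite /moore (expand_det_row _ ord0) horner_sum; apply: eq_bigr => j _.
  rewrite hornerM hornerC hornerXn mulrC; congr (_ * _).
    by rewrite mxE /cons_fun unlift_none add0n subn1.
  congr (_ * \det _); apply/matrixP=> a b; rewrite !mxE /cons_fun.
  by rewrite liftK.
(* [p] involves only powers X^(q^i), so it is linear over [F]; at each [h i] two rows of the
   determinant coincide. *)
have p_lincomb d : p.[lincomb d h] = 0.
  have -> : p.[lincomb d h] = \sum_i iota (d 0 i) * p.[h i].
    rewrite horner_sum; under [RHS]eq_bigr do rewrite horner_sum mulr_sumr.
    rewrite exchange_big; apply: eq_bigr => j _ /=.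
    rewrite hornerM hornerC hornerXn lincomb_frob mulr_sumr; apply: eq_bigr => i _.
    by rewrite hornerM hornerC hornerXn mulrCA.
  rewrite big1 // => i _; rewrite pE.
  rewrite [moore _ _](determinant_alternate (i1 := ord0) (i2 := lift ord0 i)).
  - by rewrite mulr0.
  - exact: neq_lift.
  - by move=> j; rewrite !mxE /cons_fun unlift_none liftK.
have cof0 : cof ord0 = moore (fun=> 0%N) h.
  rewrite /cof /cofactor addn0 expr0 mul1r; congr (\det _).
  apply/matrixP=> i j; rewrite !mxE /cons_fun liftK.
  congr (_ ^+ (_ ^ (_ + _))%N); rewrite /= /bump /=; lia.
pose rs := [seq lincomb c h | c <- enum 'rV[F]_k].
have size_rs : size rs = (#|F| ^ k)%N.
  by rewrite size_map -cardE card_mx mul1n.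
pose D := p - (cof ord0)%:P * \prod_(r <- rs) ('X - r%:P).
(* The leading terms cancel, so [D] has degree below q^k, yet it vanishes at q^k distinct points. *)
have D0 : D = 0.
  apply/eqP/negPn/negP => nzD.
  have : (size rs < size D)%N.
    apply: max_poly_roots => //; last by rewrite map_inj_uniq ?enum_uniq.
    apply/allP=> _ /mapP[c _ ->]; rewrite rootE hornerD hornerN hornerM.
    rewrite p_lincomb sub0r oppr_eq0 mulf_eq0; apply/orP; right.
    rewrite -/(root _ _) root_prod_XsubC map_f ?mem_enum //.
  rewrite ltnNge => /negP[]; rewrite size_rs; apply/leq_sizeP => j le_j.
  rewrite coefB coefCM coef_sum (bigD1 ord0) //= big1 => [|i i0]; last first.
    rewrite coefCM coefXn; case: eqP => [ej|]; last by rewrite mulr0.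
    move: le_j; rewrite ej leq_exp2l ?finNzRing_gt1 //.
    move: (ltn_ord i); have : (0 < i)%N by rewrite lt0n. by lia.
  rewrite addr0 coefCM coefXn subn0 -mulrBr.
  move: le_j; rewrite leq_eqVlt => /orP[/eqP <-|lt_j].
    rewrite eqxx -size_rs; have := monic_prod_XsubC rs predT id.
    by rewrite monicE lead_coefE size_prod_XsubC /= => /eqP ->; rewrite subrr mulr0.
  rewrite gtn_eqF // nth_default ?subrr ?mulr0 // size_prod_XsubC size_rs //.
rewrite -pE -cof0; move/eqP: D0; rewrite subr_eq0 => /eqP ->.
rewrite hornerM hornerC horner_prod big_map big_enum /=; congr (_ * _).
rewrite (reindex_inj oppr_inj); apply: eq_bigr => c _.
by rewrite !hornerE lincombN opprK.
Qed.

(** By [moore_cons] a smaller Moore determinant splits off; each remaining factor is a combination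
    of [z] with coefficient 1 at [z ord0], hence nonzero. *)
Lemma moore_neq0 m (z : 'I_m -> R) : indep z -> moore (fun=> 0%N) z != 0.
Proof.
elim: m z => [|m IHm] z iz; first by rewrite /moore det_mx00 oner_neq0.
pose h i := z (lift ord0 i).
have lincombE (a : F) (c : 'rV[F]_m) :
    lincomb (row_mx a%:M c : 'rV[F]_(1 + m)) z = iota a * z ord0 + lincomb c h.
  rewrite /lincomb big_ord_recl; congr (_ + _).
    have -> : ord0 = lshift m (ord0 : 'I_1) by apply: ord_inj.
    by rewrite row_mxEl mxE eqxx.
  apply: eq_bigr => i _.
  rewrite /h; have -> : lift ord0 i = rshift 1 i by apply: ord_inj.
  by rewrite row_mxEr.
have ih : indep h.
  move=> c c0; have := iz (row_mx 0%:M c : 'rV[F]_(1 + m)).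
  rewrite lincombE (rmorph0 iota) mul0r add0r; apply; apply: contraNneq c0.
  by move=> /(congr1 (@rsubmx F 1 1 m)); rewrite row_mxKr linear0 => ->.
have -> : moore (fun=> 0%N) z = moore (fun=> 0%N) (cons_fun (z ord0) h).
  congr (\det _); apply/matrixP=> i j; rewrite !mxE /cons_fun.
  by case: unliftP => [i'|] ->.
rewrite moore_cons; last exact: lincomb_inj.
rewrite mulf_neq0 ?IHm //; apply/prodf_neq0 => c _.
have := iz (row_mx 1%:M c : 'rV[F]_(1 + m)).
rewrite lincombE (rmorph1 iota) mul1r; apply; apply/eqP.
move=> /(congr1 (@lsubmx F 1 1 m)); rewrite row_mxKl linear0.
by move=> /matrixP/(_ 0 0); rewrite !mxE => /eqP; rewrite oner_eq0.
Qed.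


(** * Bases adapted to a functional *)

(** The point is that row 0 of [P] is a vector v with phi(v) = 1 and the other rows are a basis of
    ker phi. It comes from the rank-one factorization of [phi^T]. *)
Lemma exists_adapted_basis m (phi : 'rV[F]_m.+1) : phi != 0 ->
  exists2 P : 'M[F]_m.+1, P \in unitmx & P *m phi^T = delta_mx ord0 ord0.
Proof.
move=> phi0; pose L := col_ebase phi^T; pose U := row_ebase phi^T.
have rk1 : \rank phi^T = 1%N.
  apply/eqP; rewrite eqn_leq rank_leq_col lt0n mxrank_eq0.
  by apply: contra phi0 => /eqP e0; rewrite -[phi]trmxK e0 trmx0.
have LU : phi^T = L *m pid_mx 1 *m U by rewrite -{1}[phi^T]mulmx_ebase rk1.
have Lu : L \in unitmx := col_ebase_unit _.
have u0 : U 0 0 != 0.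
  by have := row_ebase_unit phi^T; rewrite unitmxE det_mx11 unitfE.
have UE : U = (U 0 0)%:M := mx11_scalar U.
move: (U 0 0) u0 UE => u u0 UE; exists (u^-1 *: invmx L).
  rewrite -mul_scalar_mx unitmx_mul unitmx_inv Lu andbT.
  by rewrite unitmxE det_scalar unitfE expf_neq0 // invr_neq0.
rewrite LU UE -scalemxAl -!mulmxA mulKmx // mul_mx_scalar scalerA.
rewrite mulVf // scale1r; apply/matrixP=> i j; rewrite !mxE ord1 andbT.
by case: i => [[|i] Hi].
Qed.

Lemma mulmx_recl m p (d : 'rV[F]_m.+1) (P : 'M[F]_(m.+1, p)) :
  d *m P = d 0 0 *: row 0 P + col' ord0 d *m row' ord0 P.
Proof.
apply/rowP=> j; rewrite !mxE big_ord_recl; congr (_ + _).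
by apply: eq_bigr => i _; rewrite !mxE.
Qed.

Lemma ker_adapted_basis m (P : 'M[F]_m.+1) (phi : 'rV[F]_m.+1)
    (a : F) (c : 'rV[F]_m) : P *m phi^T = delta_mx ord0 ord0 ->
  (a *: row 0 P + c *m row' ord0 P) *m phi^T = a%:M.
Proof.
move=> Pphi; rewrite mulmxDl -scalemxAl -row_mul Pphi -mulmxA.
have -> : row' ord0 P *m phi^T = 0.
  transitivity (row' ord0 (P *m phi^T)).
    by apply/matrixP=> i j; rewrite !mxE; apply: eq_bigr => l _; rewrite !mxE.
  by rewrite Pphi; apply/matrixP=> i j; rewrite !mxE.
by rewrite mulmx0 addr0; apply/matrixP=> i j; rewrite !mxE !ord1 !eqxx mulr1.
Qed.

Lemma adapted_basisK m (P : 'M[F]_m.+1) : P \in unitmx ->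
  cancel (fun c : 'rV[F]_m => c *m row' ord0 P)
         (fun d => d *m col' ord0 (invmx P)).
Proof.
move=> Pu c; rewrite -mulmxA -[RHS]mulmx1; congr (_ *m _).
transitivity (row' ord0 (col' ord0 (P *m invmx P))).
  by apply/matrixP=> i j; rewrite !mxE; apply: eq_bigr => l _; rewrite !mxE.
by rewrite mulmxV //; apply/matrixP=> i j; rewrite !mxE (inj_eq lift_inj).
Qed.

Lemma ker_adapted_basisK m (P : 'M[F]_m.+1) (phi d : 'rV[F]_m.+1) :
  P \in unitmx -> P *m phi^T = delta_mx ord0 ord0 -> d *m phi^T = 0 ->
  d *m col' ord0 (invmx P) *m row' ord0 P = d.
Proof.
move=> Pu Pphi d0; pose e := d *m invmx P.
have dE : d = e 0 0 *: row 0 P + col' ord0 e *m row' ord0 P.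
  by rewrite -mulmx_recl mulmxKV.
have e0 : e 0 0 = 0.
  have := ker_adapted_basis (e 0 0) (col' ord0 e) Pphi.
  by rewrite -dE d0 => /matrixP/(_ 0 0); rewrite !mxE eqxx.
rewrite [RHS]dE e0 scale0r add0r.
congr (_ *m _); apply/rowP=> j; rewrite !mxE.
by apply: eq_bigr => l _; rewrite !mxE.
Qed.

Lemma prod_ker_adapted_basis m (P : 'M[F]_m.+1) (phi : 'rV[F]_m.+1)
    (G : 'rV[F]_m.+1 -> R) :
  P \in unitmx -> P *m phi^T = delta_mx ord0 ord0 ->
  \prod_(d | d *m phi^T == 0) G d = \prod_(c : 'rV[F]_m) G (c *m row' ord0 P).
Proof.
move=> Pu Pphi.
rewrite (reindex_onto (fun c => c *m row' ord0 P)
  (fun d => d *m col' ord0 (invmx P))) => [|d /eqP]; last first.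
  exact: ker_adapted_basisK.
apply: eq_bigl => c; have := ker_adapted_basis 0 c Pphi.
rewrite scale0r add0r => ->; rewrite adapted_basisK // eqxx andbT.
by apply/eqP/matrixP=> i j; rewrite !mxE mul0rn.
Qed.

(** This is A_delta(V) = B(phi) f_H(v) with v = [row 0 P]. In the basis of rows of [P], [moore_cons]
    splits off f_H(v); the factor det P then cancels. *)
Lemma moore_factor m (P : 'M[F]_m.+1) (phi : 'rV[F]_m.+1) (z : 'I_m.+1 -> R) :
  P \in unitmx -> P *m phi^T = delta_mx ord0 ord0 -> indep z ->
  lincomb phi (moore_cof (fun=> 0%N) z) *
    \prod_(d | d *m phi^T == 0) lincomb (row 0 P + d) z
  = moore (fun=> 0%N) z.
Proof.
move=> Pu Pphi iz.
have detP : iota (\det P) != 0 by rewrite fmorph_eq0 -unitfE -unitmxE.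
apply: (mulfI detP); rewrite mulrA (moore_cof_basis _ _ Pphi) -moore_mulmx /=.
pose h i := lincomb (row (lift ord0 i) P) z.
have hE c : lincomb c h = lincomb (c *m row' ord0 P) z.
  rewrite lincomb_mul; apply: eq_bigr => i _; congr (_ * lincomb _ _).
  by apply/rowP=> j; rewrite !mxE.
rewrite (prod_ker_adapted_basis _ Pu Pphi).
have -> : moore (fun=> 0%N) (fun i => lincomb (row i P) z) =
    moore (fun=> 0%N) (cons_fun (lincomb (row 0 P) z) h).
  congr (\det _); apply/matrixP=> i j; rewrite !mxE /cons_fun.
  by case: unliftP => [i'|] ->.
rewrite moore_cons; last first.
  by move=> c d; rewrite !hE => /(lincomb_inj iz) /(can_inj (adapted_basisK Pu)).
by congr (_ * _); apply: eq_bigr => c _; rewrite lincombD hE.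
Qed.

(** This lets the induction hypothesis on H enter, with [g] standing for S_lam'(H): up to the same
    factor det P, both forms at [phi] are Moore determinants on H. *)
Lemma moore_cof_proportional m (P : 'M[F]_m.+1) (phi : 'rV[F]_m.+1)
    (lam : nat -> nat) (z : 'I_m.+1 -> R) (g : R) :
  P \in unitmx -> P *m phi^T = delta_mx ord0 ord0 ->
  let h i := lincomb (row (lift ord0 i) P) z in
  moore (fun j => lam j.+1) h = moore (fun=> 0%N) h * g ->
  lincomb phi (moore_cof lam z) = lincomb phi (moore_cof (fun=> 0%N) z) * g.
Proof.
move=> Pu Pphi h hg.
have detP : iota (\det P) != 0 by rewrite fmorph_eq0 -unitfE -unitmxE.
by apply: (mulfI detP); rewrite mulrA !(moore_cof_basis _ _ Pphi).
Qed.

(** * Summation over functionals *)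

(** The powers q^(m - s) already form column [s], so two columns are equal. *)
Lemma sum_moore_cof_alternate m (z : 'I_m.+1 -> R) (s : nat) : (0 < s <= m)%N ->
  \sum_i z i ^+ (#|F| ^ (m - s))%N * moore_cof (fun=> 0%N) z i = 0.
Proof.
case/andP=> s0 sm; rewrite -det_moore_col -det_tr.
have lt_s : (s < m.+1)%N by [].
apply: (determinant_alternate (i1 := ord0) (i2 := Ordinal lt_s)).
  by rewrite -val_eqE /= eq_sym -lt0n.
move=> i; rewrite !mxE eqxx -val_eqE /= (gtn_eqF s0).
by rewrite add0n subn1.
Qed.

(* Pairing both sides with the vectors [y_i ^+ (q^s)] of Frobenius powers of the
   cofactors [y], for [s <= m], reduces the identity to [sum_lincomb_pow]; these
   vectors separate points because the Moore determinant of [y] is nonzero. *)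
Lemma sum_linear_forms m (z : 'I_m.+1 -> R) (f : 'rV[F]_m.+1 -> R) : indep z ->
  (forall phi, phi != 0 ->
     lincomb phi (moore_cof (fun=> 0%N) z) * f phi = moore (fun=> 0%N) z) ->
  forall i, \sum_(phi : 'rV[F]_m.+1 | phi != 0) iota (- phi 0 i) * f phi
            = z i ^+ (#|F| ^ m)%N.
Proof.
move=> iz fE; pose y := moore_cof (fun=> 0%N) z; pose A := moore (fun=> 0%N) z.
have A0 : A != 0 := moore_neq0 iz.
have iy : indep y.
  by move=> c c0; move: A0; rewrite /A -(fE c c0) mulf_eq0 => /norP[].
pose T : 'rV[R]_m.+1 :=
  \row_i (\sum_(phi : 'rV[F]_m.+1 | phi != 0) iota (- phi 0 i) * f phi - z i ^+ (#|F| ^ m)%N).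
pose Y : 'M[R]_m.+1 := \matrix_(i, j) y i ^+ (#|F| ^ (0 + (m.+1 - 1 - j)))%N.
have TY : T *m Y = 0.
  apply/rowP=> j; rewrite !mxE.
  set s := (m - j)%N; have le_sm : (s <= m)%N := leq_subr _ _.
  under eq_bigr do rewrite !mxE mulrBl.
  rewrite sumrB; apply/eqP; rewrite subr_eq0; apply/eqP.
  have -> : \sum_i z i ^+ (#|F| ^ m)%N * y i ^+ (#|F| ^ (0 + (m.+1 - 1 - j)))%N
      = (\sum_i z i ^+ (#|F| ^ (m - s))%N * y i) ^+ (#|F| ^ s)%N.
    rewrite frob_sum; apply: eq_bigr => i _.
    by rewrite [RHS]exprMn -exprM -expnD subnK // add0n subn1.
  (* Summing over i produces B(phi)^(q^s), one factor of which combines with [f phi] into [A]. *)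
  transitivity (- (\sum_(phi : 'rV[F]_m.+1 | phi != 0) lincomb phi y ^+ (#|F| ^ s).-1) * A).
    under eq_bigr do rewrite mulr_suml.
    rewrite exchange_big mulNr mulr_suml -sumrN; apply: eq_bigr => phi phi0 /=.
    rewrite /A -(fE phi phi0) mulrA -exprSr prednK; last by rewrite lt0n frob_neq0.
    rewrite lincomb_frob mulr_suml -sumrN; apply: eq_bigr => i _.
    by rewrite add0n subn1 rmorphN !mulNr mulrAC.
  (* The term phi = 0 of the full sum is 0^(q^s - 1). For s = 0 it is 1, the other terms add up to
     -1, and the expansion of [A] remains; for s > 0 it is 0 and both sides vanish. *)
  have := @sum_lincomb_pow _ y s le_sm; rewrite (bigD1 0) //= lincomb0.
  case: (posnP s) => [s0|s_gt0].
    rewrite s0 expn0 expr0 subn0 expr1 => /eqP; rewrite addrC addr_eq0 => /eqP ->.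
    rewrite opprK mul1r /A moore_expand; apply: eq_bigr => i _.
    by rewrite add0n.
  rewrite sum_moore_cof_alternate ?s_gt0 // expr0n (negPf (frob_neq0 s)).
  rewrite expr0n -subn1 subn_eq0 leqNgt (ltn_exp2l 0) ?finNzRing_gt1 // s_gt0 /=.
  by rewrite add0r => ->; rewrite oppr0 mul0r.
have detY : \det Y != 0 := moore_neq0 iy.
have T0 : T = 0.
  have : T *m Y *m \adj Y = 0 by rewrite TY mul0mx.
  rewrite -mulmxA mul_mx_adj mul_mx_scalar => /rowP T0.
  apply/rowP=> i; move: (T0 i); rewrite !mxE => /eqP.
  by rewrite mulf_eq0 (negPf detY) => /eqP.
move=> i; apply/eqP; rewrite -subr_eq0; have /rowP/(_ i) := T0.
by rewrite !mxE => ->.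
Qed.

(** Here [f phi] is f_H(v) and [g phi] is S_lam'(H). Once the power of [sum_linear_forms] is
    inserted into the first-column expansion, the sum over i collapses to
    [lincomb phi (moore_cof lam z)], and one factor [f phi] is absorbed into A_delta(V). *)
Lemma moore_sum_hyperplanes m (lam : nat -> nat) (z : 'I_m.+1 -> R)
    (f g : 'rV[F]_m.+1 -> R) : indep z ->
  (forall phi, phi != 0 ->
     lincomb phi (moore_cof (fun=> 0%N) z) * f phi = moore (fun=> 0%N) z) ->
  (forall phi, phi != 0 -> lincomb phi (moore_cof lam z) =
     lincomb phi (moore_cof (fun=> 0%N) z) * g phi) ->
  moore lam z = moore (fun=> 0%N) z *
    - \sum_(phi : 'rV[F]_m.+1 | phi != 0) f phi ^+ (#|F| ^ lam 0 - 1)%N * g phi.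
Proof.
move=> iz fE gE; rewrite moore_expand.
transitivity (\sum_i \sum_(phi : 'rV[F]_m.+1 | phi != 0)
    (iota (- phi 0 i) * f phi ^+ (#|F| ^ lam 0)%N) * moore_cof lam z i).
  apply: eq_bigr => i _; rewrite -mulr_suml; congr (_ * _).
  rewrite addnC expnD exprM -(sum_linear_forms iz fE) frob_sum.
  by apply: eq_bigr => phi _; rewrite exprMn frob_scalar.
rewrite exchange_big mulrN mulr_sumr -sumrN; apply: eq_bigr => phi phi0 /=.
rewrite -(fE phi phi0).
transitivity (- (f phi ^+ (#|F| ^ lam 0)%N * lincomb phi (moore_cof lam z))).
  rewrite mulr_sumr -sumrN; apply: eq_bigr => i _.
  by rewrite rmorphN !mulNr [X in _ = - X]mulrCA [X in _ = - X]mulrA.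
rewrite (gE phi phi0) -{1}(@subnK 1 (#|F| ^ lam 0)%N) ?lt0n ?frob_neq0 //.
by rewrite addn1 exprS [in LHS]mulrACA [f phi * _]mulrC.
Qed.

End Moore.

(** * Weighted sums over paths *)

Section FlagSum.
Variables (T : finType) (S : comNzRingType).

(** The step weights shift with each recursion, so the tail of a flag is again a path sum, as the
    induction on dim V requires. *)
Fixpoint path_sum (c : nat -> T -> T -> S) (e : T -> S) (k : nat) (W : T) : S :=
  if k is k'.+1 then \sum_(H : T) c 0 W H * path_sum (fun i => c i.+1) e k' H
  else e W.

Lemma path_sumE (c : nat -> T -> T -> S) (e : T -> S) (k : nat) (W : T) :
  \sum_(f : {ffun 'I_k.+1 -> T} | f ord0 == W)
    (\prod_(i < k) c i (f (inord i)) (f (inord i.+1))) * e (f ord_max)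
  = path_sum c e k W.
Proof.
elim: k c W => [|k IHk] c W /=.
  rewrite (big_pred1 [ffun=> W]) => [|f]; first by rewrite big_ord0 mul1r ffunE.
  apply/eqP/eqP => [fW|->]; last by rewrite ffunE.
  by apply/ffunP=> i; rewrite ffunE ord1.
pose h (p : T * {ffun 'I_k.+1 -> T}) : {ffun 'I_k.+2 -> T} :=
  [ffun i => if unlift ord0 i is Some j then p.2 j else p.1].
have h0 p : h p ord0 = p.1 by rewrite ffunE unlift_none.
have hS p j : h p (lift ord0 j) = p.2 j by rewrite ffunE liftK.
rewrite (reindex h) /=; last first.
  exists (fun f => (f ord0, [ffun j => f (lift ord0 j)])) => [[a g]|f] _.
    by rewrite h0; congr (_, _); apply/ffunP=> j; rewrite ffunE hS.
  by apply/ffunP=> i; rewrite ffunE; case: unliftP => [j|] -> //=; rewrite ffunE.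
transitivity (\sum_(p : T * {ffun 'I_k.+1 -> T} | (p.1 == W) && true)
   c 0 p.1 (p.2 ord0) * ((\prod_(i < k) c i.+1 (p.2 (inord i)) (p.2 (inord i.+1)))
     * e (p.2 ord_max))).
  apply: eq_big => [p|p _]; first by rewrite h0 andbT.
  rewrite big_ord_recl mulrA; congr (_ * _ * e _).
  - congr (c 0 _ _).
      by rewrite -[RHS](h0 p); congr (h p _); apply: val_inj; rewrite /= inordK.
    by rewrite -hS; congr (h p _); apply: val_inj; rewrite /= inordK.
  - apply: eq_bigr => i _; have lt_ik := ltn_ord i.
    by congr (c _ _ _); rewrite -hS; congr (h p _); apply: val_inj;
      rewrite /= ?/bump /= !inordK //; lia.
  - by rewrite -hS; congr (h p _); apply: val_inj.
rewrite -(pair_big (pred1 W) predT (fun a (g : {ffun 'I_k.+1 -> T}) =>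
  c 0 a (g ord0) * ((\prod_(i < k) c i.+1 (g (inord i)) (g (inord i.+1)))
     * e (g ord_max)))) /= big_pred1_eq.
rewrite (partition_big (fun g : {ffun 'I_k.+1 -> T} => g ord0) predT) //=.
apply: eq_bigr => H _; rewrite -IHk mulr_sumr.
by apply: eq_bigr => g /eqP ->.
Qed.

End FlagSum.

(** * Subspaces as finite sets, and kernels of functionals *)

Section Subspaces.
Variables (F : finFieldType) (n : nat).
Implicit Types (A H W : {set 'rV[F]_n}).

Lemma subspaceP A : reflect
  (0 \in A /\ forall (a : F) x y, x \in A -> y \in A -> a *: x + y \in A)
  (is_subspace A).
Proof.
apply: (iffP andP) => -[A0 Acl]; split=> //.
  move=> a x y Ax Ay.
  by have /forallP/(_ a)/forall_inP/(_ x Ax)/forall_inP/(_ y Ay) := Acl.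
by apply/forallP=> a; apply/forall_inP=> x Ax; apply/forall_inP=> y; apply: Acl.
Qed.

Lemma subspace_sum A (I : finType) (d : I -> F) (x : I -> 'rV[F]_n) :
  is_subspace A -> (forall i, x i \in A) -> \sum_i d i *: x i \in A.
Proof.
move=> /subspaceP[A0 Acl] xA; elim/big_rec: _ => // i y _ Ay.
exact: Acl.
Qed.

(** For v in W outside H, the q translates a v + H are disjoint and lie in W. Cardinality takes the
    place of dimension. *)
Lemma card_proper_subspace H W : is_subspace H -> is_subspace W ->
  H \proper W -> (#|F| * #|H| <= #|W|)%N.
Proof.
move=> /subspaceP[H0 Hcl] /subspaceP[W0 Wcl] /properP[sHW [v Wv Hv]].
pose h (p : F * 'rV[F]_n) := p.1 *: v + p.2.
have inj : {in setX [set: F] H &, injective h}.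
  move=> [a x] [b y]; rewrite !inE /= /h /= => Hx Hy eq_h.
  have [eab|nab] := eqVneq a b.
    by move: eq_h; rewrite eab => /addrI ->.
  case/negP: Hv; have -> : v = (a - b)^-1 *: (y - x) + 0.
    have -> : y - x = (a - b) *: v.
      have av : a *: v = b *: v + (y - x) by rewrite addrA -eq_h addrK.
      by rewrite scalerBl av [RHS]addrC addKr.
    by rewrite scalerA mulVf ?subr_eq0 // scale1r addr0.
  apply: (Hcl) => //; rewrite addrC -scaleN1r; exact: Hcl.
rewrite -[#|F|]cardsT -cardsX -(card_in_imset inj); apply: subset_leq_card.
apply/subsetP=> _ /imsetP[[a x] /setXP[_ Hx] ->].
exact: Wcl Wv (subsetP sHW x Hx).
Qed.

Definition kerset m (phi : 'rV[F]_m) : {set 'rV[F]_m} :=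
  [set d | d *m phi^T == 0].

(** One fixed adapted basis per functional; the default is reached only at phi = 0. *)
Definition adapted m (phi : 'rV[F]_m.+1) : 'M[F]_m.+1 :=
  odflt 1%:M [pick P : 'M[F]_m.+1 |
    (P \in unitmx) && (P *m phi^T == delta_mx ord0 ord0)].

Lemma adaptedP m (phi : 'rV[F]_m.+1) : phi != 0 ->
  adapted phi \in unitmx /\ adapted phi *m phi^T = delta_mx ord0 ord0.
Proof.
move=> phi0; rewrite /adapted; case: pickP => [P /andP[Pu /eqP]|no] //.
have [P Pu Pphi] := exists_adapted_basis phi0.
by have := no P; rewrite Pu Pphi eqxx.
Qed.

Lemma kerset_adapted m (phi : 'rV[F]_m.+1) : phi != 0 ->
  kerset phi = [set c *m row' ord0 (adapted phi) | c : 'rV[F]_m].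
Proof.
move=> /adaptedP[Pu Pphi]; apply/setP=> d; rewrite inE.
apply/eqP/imsetP => [d0|[c _ ->]].
  exists (d *m col' ord0 (invmx (adapted phi))) => //.
  exact: esym (ker_adapted_basisK Pu Pphi d0).
have := ker_adapted_basis 0 c Pphi; rewrite scale0r add0r => ->.
by apply/matrixP=> i j; rewrite !mxE mul0rn.
Qed.

Lemma card_kerset m (phi : 'rV[F]_m.+1) : phi != 0 ->
  #|kerset phi| = (#|F| ^ m)%N.
Proof.
move=> phi0; have [Pu _] := adaptedP phi0.
rewrite kerset_adapted // card_imset; last exact: can_inj (adapted_basisK Pu).
by rewrite card_mx mul1n.
Qed.

Lemma adapted_row0 m (phi : 'rV[F]_m.+1) : phi != 0 ->
  row 0 (adapted phi) *m phi^T = 1%:M.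
Proof.
move=> /adaptedP[_ Pphi]; have := ker_adapted_basis 1 0 Pphi.
by rewrite mul0mx addr0 scale1r.
Qed.

Lemma kerset_decomp m (phi c : 'rV[F]_m.+1) : phi != 0 ->
  c - (c *m phi^T) 0 0 *: row 0 (adapted phi) \in kerset phi.
Proof.
move=> phi0; rewrite inE mulmxBl -scalemxAl adapted_row0 // scalemx1.
by rewrite -mx11_scalar subrr.
Qed.

Lemma kerset_eq m (phi psi : 'rV[F]_m.+1) : phi != 0 -> psi != 0 ->
  (kerset psi == kerset phi) = (psi \in [set a *: phi | a in predC1 0]).
Proof.
move=> phi0 psi0; apply/eqP/imsetP => [eqk|[a a0 ->]]; last first.
  apply/setP=> d; rewrite !inE linearZ /= -scalemxAr scalemx_eq0.
  by rewrite (negPf a0).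
pose r := row 0 (adapted phi) *m psi^T; pose a := r 0 0.
(* [psi] kills e_j - phi_j v for v = [row 0 (adapted phi)], hence psi_j = psi(v) phi_j. *)
have psiE : psi = a *: phi.
  apply/rowP=> j; have := kerset_decomp (delta_mx 0 j) phi0.
  rewrite -eqk inE mulmxBl -scalemxAl subr_eq0 => /eqP/matrixP/(_ 0 0).
  by rewrite -/r /a; move: r {a} => r; rewrite -!rowE !mxE mulrC.
exists a => //; rewrite inE; apply: contraNneq psi0 => a0.
by rewrite psiE a0 scale0r.
Qed.

Lemma card_kerset_fiber m (phi : 'rV[F]_m.+1) : phi != 0 ->
  #|[pred psi : 'rV[F]_m.+1 | (psi != 0) && (kerset psi == kerset phi)]|
  = #|F|.-1.
Proof.
move=> phi0; rewrite -(cardC1 (0 : F)).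
rewrite -(card_imset (predC1 0) (f := fun a => a *: phi)); last first.
  move=> a b /eqP; rewrite -subr_eq0 -scalerBl scalemx_eq0 (negPf phi0) orbF.
  by rewrite subr_eq0 => /eqP.
apply: eq_card => psi; rewrite !inE.
have [->|psi0] /= := eqVneq psi 0; last by rewrite kerset_eq.
apply/esym/imsetP => -[a a0 /eqP]; rewrite eq_sym scalemx_eq0 (negPf phi0) orbF.
by apply/negP.
Qed.

(** Take all elements of A as rows of a matrix. As A is proper, the rank is not full, and a nonzero
    column of the cokernel is the functional. *)
Lemma subspace_sub_kerset A :
  is_subspace A -> A != [set: 'rV[F]_n] ->
  exists2 phi : 'rV[F]_n, phi != 0 & A \subset kerset phi.
Proof.
move=> subA nA; pose M : 'M[F]_(#|A|, n) := \matrix_i enum_val i.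
have rowM i : row i M \in A by rewrite rowK enum_valP.
have nfull : cokermx M != 0.
  rewrite cokermx_eq0; apply: contra nA => /row_fullP[N NM].
  apply/eqP/setP=> c; rewrite inE; apply/idP.
  rewrite -[c]mulmx1 -NM mulmxA mulmx_sum_row.
  exact: (subspace_sum (fun i => (c *m N) 0 i) subA rowM).
have [i [j Mij]] : exists i j, cokermx M i j != 0.
  by have /matrix0Pn := nfull.
exists (col j (cokermx M))^T.
  by apply/rV0Pn; exists i; rewrite 2!mxE.
apply/subsetP=> d Ad; rewrite inE trmxK colE mulmxA.
have -> : d = row (enum_rank_in Ad d) M by rewrite rowK enum_rankK_in.
by rewrite -row_mul mulmx_coker row0 mul0mx.
Qed.

End Subspaces.

(** * Hyperplanes in S and the induction along flags *)

Section FlagExpansion.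
Variables (F : finFieldType) (n : nat).
Implicit Types (H W : {set 'rV[F]_n}) (lam : nat -> nat).

Local Notation iota := (@mpolyC n F).

Definition rowset m (B : 'M[F]_(m, n)) : {set 'rV[F]_n} :=
  [set c *m B | c : 'rV[F]_m].

Definition row_emb m (B : 'M[F]_(m, n)) (i : 'I_m) : {mpoly F[n]} :=
  emb (row i B).

Definition hyperplane m (B : 'M[F]_(m, n)) (phi : 'rV[F]_m) : {set 'rV[F]_n} :=
  [set c *m B | c in kerset phi].

Lemma embE (v : 'rV[F]_n) : emb v = lincomb iota v (fun i => 'X_i).
Proof. by apply: eq_bigr => i _; rewrite mul_mpolyC. Qed.

Lemma emb_eq0 (v : 'rV[F]_n) : (emb v == 0) = (v == 0).
Proof.
apply/eqP/eqP => [ev|->]; last by rewrite embE lincomb0.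
apply/rowP=> j; rewrite mxE.
have := congr1 (mcoeff U_(j)) ev; rewrite mcoeff0 raddf_sum (bigD1 j) //=.
rewrite mcoeffZ mcoeffX eqxx mulr1 big1 ?addr0 // => i ij.
by rewrite mcoeffZ mcoeffX eq_mnm1 (negPf ij) mulr0.
Qed.

Lemma emb_mulmx m (c : 'rV[F]_m) (B : 'M[F]_(m, n)) :
  emb (c *m B) = lincomb iota c (row_emb B).
Proof. by rewrite embE lincomb_mul; apply: eq_bigr => i _; rewrite /row_emb embE. Qed.

Lemma indep_row_emb m (B : 'M[F]_(m, n)) : row_free B -> indep iota (row_emb B).
Proof.
move=> freeB c c0; rewrite -emb_mulmx emb_eq0.
apply: contra c0 => /eqP cB; apply/eqP; apply: (row_free_inj freeB).
by rewrite cB mul0mx.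
Qed.

Lemma rowset_subspace m (B : 'M[F]_(m, n)) : is_subspace (rowset B).
Proof.
apply/subspaceP; split=> [|a _ _ /imsetP[c _ ->] /imsetP[d _ ->]].
  by apply/imsetP; exists 0; rewrite ?mul0mx.
by apply/imsetP; exists (a *: c + d); rewrite // mulmxDl scalemxAl.
Qed.

Lemma card_rowset m (B : 'M[F]_(m, n)) : row_free B ->
  #|rowset B| = (#|F| ^ m)%N.
Proof. by move=> freeB; rewrite card_imset ?card_mx ?mul1n //; apply: row_free_inj. Qed.

Lemma hyperplane_rowset m (B : 'M[F]_(m.+1, n)) (phi : 'rV[F]_m.+1) : phi != 0 ->
  hyperplane B phi = rowset (row' ord0 (adapted phi) *m B).
Proof.
move=> phi0; rewrite /hyperplane kerset_adapted // -imset_comp.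
by apply: eq_imset => c /=; rewrite mulmxA.
Qed.

Lemma row'_adapted_free m (B : 'M[F]_(m.+1, n)) (phi : 'rV[F]_m.+1) :
  phi != 0 -> row_free B -> row_free (row' ord0 (adapted phi) *m B).
Proof.
move=> /adaptedP[Pu _] freeB; apply/row_freeP.
have [N BN] := row_freeP freeB.
exists (N *m col' ord0 (invmx (adapted phi))).
rewrite mulmxA -(mulmxA (row' _ _)) BN mulmx1.
apply/row_matrixP=> i; rewrite row_mul -[row i 1%:M]mul1mx.
rewrite -(adapted_basisK Pu (row i 1%:M)) mul1mx; congr (_ *m _).
by rewrite -row_mul mul1mx.
Qed.

Lemma hyperplane_proper m (B : 'M[F]_(m.+1, n)) (phi : 'rV[F]_m.+1) :
  phi != 0 -> row_free B -> hyperplane B phi \proper rowset B.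
Proof.
move=> phi0 freeB; rewrite properEcard.
apply/andP; split; first by apply: imsetS; apply/subsetP.
rewrite hyperplane_rowset // !card_rowset ?row'_adapted_free //.
by rewrite ltn_exp2l ?finNzRing_gt1.
Qed.

(** In coordinates H is a proper subspace, hence inside some ker phi; the lower bound on its
    cardinality forces equality. *)
Lemma exists_hyperplane m (B : 'M[F]_(m.+1, n)) H : row_free B ->
  is_subspace H -> H \proper rowset B -> (#|F| ^ m <= #|H|)%N ->
  exists2 phi : 'rV[F]_m.+1, phi != 0 & hyperplane B phi = H.
Proof.
move=> freeB /subspaceP[H0 Hcl] /properP[sHB [w /imsetP[c _ ->] Hw]] leH.
pose A : {set 'rV[F]_m.+1} := [set d | d *m B \in H].
have subA : is_subspace A.
  apply/subspaceP; split=> [|a x y]; rewrite !inE ?mul0mx // => Hx Hy.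
  by rewrite mulmxDl -scalemxAl Hcl.
have nA : A != setT by apply: contraNneq Hw => AT; move: (in_setT c); rewrite -AT inE.
have [phi phi0 sA] := subspace_sub_kerset subA nA.
exists phi => //; apply/esym/eqP; rewrite eqEcard.
rewrite hyperplane_rowset // card_rowset ?row'_adapted_free // leH andbT.
rewrite -hyperplane_rowset //; apply/subsetP=> x Hx.
have /imsetP[d _ xE] := subsetP sHB x Hx; rewrite xE; apply: imset_f.
by apply: (subsetP sA); rewrite inE -xE.
Qed.

(** The condition on [t] makes each H with a nonzero term a hyperplane. Its fibre has q - 1
    functionals, and q - 1 = -1 in [F]. *)
Lemma sum_hyperplanes m (B : 'M[F]_(m.+1, n)) (t : {set 'rV[F]_n} -> {mpoly F[n]}) :
  row_free B ->
  (forall H, t H != 0 ->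
     [/\ is_subspace H, H \proper rowset B & (#|F| ^ m <= #|H|)%N]) ->
  \sum_(phi : 'rV[F]_m.+1 | phi != 0) t (hyperplane B phi) = - \sum_H t H.
Proof.
move=> freeB tP; rewrite (partition_big (hyperplane B) predT) //= -sumrN.
apply: eq_bigr => H _.
rewrite (eq_bigr (fun=> t H)) => [|phi /andP[_ /eqP-> //]].
have [->|tH] := eqVneq (t H) 0; first by rewrite big1 ?oppr0.
have [subH propH leH] := tP H tH.
have [phi phi0 <-] := exists_hyperplane freeB subH propH leH.
rewrite sumr_const; set N := #|_|.
have -> : N = #|F|.-1.
  rewrite -(card_kerset_fiber phi0); apply: eq_card => psi; rewrite !inE.
  congr (_ && _); apply/eqP/eqP => [|eqk]; last by rewrite /hyperplane eqk.
  exact: imset_inj (row_free_inj freeB) _ _.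
rewrite -[LHS]mulr_natl -(rmorph_nat iota) natr_card_pred.
by rewrite rmorphN1 mulN1r.
Qed.

(** For phi <> 0 this is f_H(v), where v has coordinates [row 0 (adapted phi)], so that phi(v) =
    1. *)
Definition hyper_val m (B : 'M[F]_(m.+1, n)) (phi : 'rV[F]_m.+1) : {mpoly F[n]} :=
  \prod_(d | d *m phi^T == 0) lincomb iota (row 0 (adapted phi) + d) (row_emb B).

(** A translation of ker phi replaces the vector by a v, where a is its value under [phi]. If a <>
    0, scaling ker phi by a extracts a^(q^m) = a; if a = 0, the factor at d = 0 vanishes. *)
Lemma fW_hyperplane m (B : 'M[F]_(m.+1, n)) (phi c : 'rV[F]_m.+1) :
  row_free B -> phi != 0 ->
  fW (hyperplane B phi) (emb (c *m B))
  = iota ((c *m phi^T) 0 0) * hyper_val B phi.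
Proof.
move=> freeB phi0; rewrite /fW big_imset /=; last first.
  by move=> x y _ _; apply: row_free_inj.
set a := (c *m phi^T) 0 0; set v := row 0 (adapted phi).
have hK : (c - a *: v) *m phi^T = 0.
  by apply/eqP; have := kerset_decomp c phi0; rewrite inE.
transitivity (\prod_(d in kerset phi) lincomb iota (a *: v + d) (row_emb B)).
  rewrite [RHS](reindex_inj (addrI (c - a *: v))) /=.
  apply: eq_big => [d|d _].
    by rewrite !inE [in RHS]mulmxDl hK add0r.
  by rewrite !emb_mulmx -lincombD addrA [a *: v + _]addrC subrK.
have [->|a0] := eqVneq a 0.
  rewrite rmorph0 mul0r (bigD1 0) /=; last by rewrite inE mul0mx.
  by rewrite scale0r addr0 lincomb0 mul0r.
rewrite (reindex_inj (scalerI a0)) /=.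
transitivity (\prod_(d in kerset phi) (iota a * lincomb iota (v + d) (row_emb B))).
  apply: eq_big => [d|d _]; last by rewrite -scalerDr lincombZ.
  by rewrite !inE -scalemxAl scalemx_eq0 (negPf a0).
rewrite big_split /= prodr_const card_kerset // -rmorphXn expf_card_iter.
by congr (_ * _); apply: eq_bigl => d; rewrite inE.
Qed.

Lemma hyper_valP m (B : 'M[F]_(m.+1, n)) (phi : 'rV[F]_m.+1) :
  row_free B -> phi != 0 ->
  lincomb iota phi (moore_cof F (fun=> 0%N) (row_emb B)) * hyper_val B phi
  = moore F (fun=> 0%N) (row_emb B).
Proof.
move=> freeB phi0; have [Pu Pphi] := adaptedP phi0.
exact: moore_factor Pu Pphi (indep_row_emb freeB).
Qed.

Lemma hyper_val_neq0 m (B : 'M[F]_(m.+1, n)) (phi : 'rV[F]_m.+1) :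
  row_free B -> phi != 0 -> hyper_val B phi != 0.
Proof.
move=> freeB phi0; have := moore_neq0 (indep_row_emb freeB).
by rewrite -(hyper_valP freeB phi0) mulf_eq0 => /norP[].
Qed.

(** By [fW_hyperplane] the quotient is the line F f_H(v), and the nonzero scalars multiply to -1. *)
Lemma pi_quot_hyperplane m (B : 'M[F]_(m.+1, n)) (phi : 'rV[F]_m.+1) :
  row_free B -> phi != 0 ->
  pi_quot (rowset B) (hyperplane B phi) = - hyper_val B phi ^+ #|F|.-1.
Proof.
move=> freeB phi0; set f := hyper_val B phi.
have f0 : f != 0 := hyper_val_neq0 freeB phi0.
rewrite /pi_quot -big_filter.
rewrite (perm_big [seq iota a * f | a <- enum (predC1 (0 : F))]) /=; last first.
  apply: uniq_perm; first by rewrite filter_uniq ?undup_uniq.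
    rewrite map_inj_uniq ?enum_uniq // => a b /(mulIf f0).
    exact: (fmorph_inj iota).
  move=> y; rewrite mem_filter mem_undup; apply/andP/mapP => [[y0]|[a]].
    move=> /mapP[_ /[!mem_enum] /imsetP[c _ ->] yE].
    exists ((c *m phi^T) 0 0); last by rewrite yE fW_hyperplane.
    rewrite mem_enum inE; apply: contraNneq y0 => c0.
    by rewrite yE fW_hyperplane // c0 rmorph0 mul0r.
  rewrite mem_enum inE => a0 ->; split.
    by rewrite mulf_neq0 // fmorph_eq0.
  apply/mapP; exists ((a *: row 0 (adapted phi)) *m B).
    by rewrite mem_enum; apply: imset_f.
  rewrite fW_hyperplane // -scalemxAl adapted_row0 //.
  by rewrite !mxE eqxx mulr1.
rewrite big_map big_enum big_split /= prodr_const cardC1 -rmorph_prod.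
by rewrite prod_nonzero_finField rmorphN1 mulN1r.
Qed.

(** The Boolean factor kills steps that cannot occur in a flag, so sums may range over all sequences
    of sets. *)
Definition edge lam (i : nat) W H : {mpoly F[n]} :=
  (is_subspace H && (H \proper W))%:R *
  pi_quot W H ^+ ((qq F ^ lam i - 1) %/ (qq F - 1))%N.

Definition flag_sum lam (k : nat) W : {mpoly F[n]} :=
  path_sum (edge lam) (fun W => (W == [set 0])%:R) k W.

(** A nonzero sum contains k strict inclusions of subspaces, each multiplying the cardinality by at
    least q. This bound forces the first step of a contributing flag to be a hyperplane. *)
Lemma flag_sum_card lam k W : is_subspace W -> flag_sum lam k W != 0 ->
  (#|F| ^ k <= #|W|)%N.
Proof.
elim: k lam W => [|k IHk] lam W subW.
  rewrite expn0 card_gt0 => _; apply/set0Pn; exists 0.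
  by case/subspaceP: subW.
have [/existsP[H /andP[eH nz]] _|/existsPn none] :=
  boolP [exists H, (edge lam 0 W H != 0)
           && (flag_sum (fun i => lam i.+1) k H != 0)].
  have [subH propH] : is_subspace H /\ H \proper W.
    apply/andP; apply: contraNT eH => /negPf eb.
    by rewrite /edge eb mul0r.
  rewrite expnS; apply: leq_trans (card_proper_subspace subH subW propH).
  by rewrite leq_mul2l (IHk _ _ subH nz) orbT.
case/negP; rewrite /flag_sum /= big1 // => H _; apply/eqP; rewrite mulf_eq0.
by have := none H; rewrite negb_and !negbK.
Qed.

Lemma edge_hyperplane m lam (B : 'M[F]_(m.+1, n)) (phi : 'rV[F]_m.+1) :
  row_free B -> phi != 0 ->
  edge lam 0 (rowset B) (hyperplane B phi)
  = (-1) ^+ lam 0 * hyper_val B phi ^+ (#|F| ^ lam 0 - 1)%N.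
Proof.
move=> freeB phi0; rewrite /edge hyperplane_proper // hyperplane_rowset //.
rewrite rowset_subspace -hyperplane_rowset // mul1r pi_quot_hyperplane //.
rewrite [LHS]exprNn -[X in _ * X]exprM /qq; congr (_ * _ ^+ _).
  by rewrite -(rmorphN1 iota) -!rmorphXn /= sign_repunit.
by rewrite !subn1 mulnC divnK // predn_exp dvdn_mulr.
Qed.

(** The induction runs over all [B] and [lam], since its step passes to a basis of each hyperplane
    and to the shifted sequence. *)
Lemma moore_flag_sum k lam (B : 'M[F]_(k, n)) : row_free B ->
  moore F lam (row_emb B) = moore F (fun=> 0%N) (row_emb B) *
    ((-1) ^+ (\sum_(i < k) lam i)%N * flag_sum lam k (rowset B)).
Proof.
elim: k lam B => [|k IHk] lam B freeB.
  rewrite /moore !det_mx00 big_ord0 expr0 !mul1r /flag_sum /=.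
  suff -> : rowset B = [set 0] by rewrite eqxx.
  apply/setP=> w; rewrite !inE; apply/imsetP/eqP => [[c _ ->]|->].
    by rewrite [B]flatmx0 mulmx0.
  by exists 0; rewrite ?mul0mx.
pose lam' i := lam i.+1.
pose g phi := (-1) ^+ (\sum_(i < k) lam' i)%N
  * flag_sum lam' k (hyperplane B phi).
rewrite (moore_sum_hyperplanes (f := hyper_val B) (g := g)
  (indep_row_emb freeB)); last 2 first.
- by move=> phi phi0; apply: hyper_valP.
- move=> phi phi0; have [Pu Pphi] := adaptedP phi0.
  apply: (moore_cof_proportional Pu Pphi).
  pose B' := row' ord0 (adapted phi) *m B.
  have hE : (fun i => lincomb iota (row (lift ord0 i) (adapted phi)) (row_emb B))
      =1 row_emb B'.
    move=> i; rewrite -emb_mulmx /row_emb row_mul; congr (emb (_ *m _)).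
    by apply/rowP=> j; rewrite !mxE.
  have mE mu : moore F mu (fun i =>
      lincomb iota (row (lift ord0 i) (adapted phi)) (row_emb B))
      = moore F mu (row_emb B').
    by congr (\det _); apply/matrixP=> i j; rewrite !mxE hE.
  by rewrite !mE IHk ?row'_adapted_free // /g hyperplane_rowset.
congr (_ * _).
pose t H := edge lam 0 (rowset B) H * flag_sum lam' k H.
have := @sum_hyperplanes k B t freeB; rewrite -[\sum_H t H]/(flag_sum lam k.+1 _).
move=> sumE; rewrite -[flag_sum _ _ _]opprK -sumE => [|H]; last first.
  rewrite mulf_eq0 => /norP[eH nz].
  have [subH propH] : is_subspace H /\ H \proper rowset B.
    apply/andP; apply: contraNT eH => /negPf eb.
    by rewrite /edge eb mul0r.
  by split=> //; apply: flag_sum_card nz.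
rewrite mulrN mulr_sumr; congr (- _); apply: eq_bigr => phi phi0.
rewrite /t /g edge_hyperplane // big_ord_recl addnC exprD.
rewrite -[LHS]mulrCA -!mulrA; congr (_ * _).
(* The sign (-1)^(lam 0) of the edge meets the same sign from (-1)^|lam|, and they cancel. *)
by rewrite !mulrA -expr2 sqrr_sign mul1r.
Qed.

End FlagExpansion.

(** * From path sums to complete flags and the quotient S_lambda(V) *)

(** The flag conditions are distributed over the path: strictness and being a subspace go to the
    edges, V_n = 0 to the end weight, V_0 = V to the starting point. *)
Lemma complete_flag_sum (F : finFieldType) (n : nat) (lam : nat -> nat) :
  \sum_(Fl : {ffun 'I_n.+1 -> {set 'rV[F]_n}} | is_complete_flag Fl)
     \prod_(i < n) pi_flag (F:=F) Fl i ^+ ((qq F ^ lam i - 1) %/ (qq F - 1))%N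
  = flag_sum lam n [set: 'rV[F]_n].
Proof.
rewrite /flag_sum -path_sumE big_mkcond [RHS]big_mkcond.
apply: eq_bigr => Fl _; rewrite big_split /=.
have [/andP[/andP[/andP[/forallP sub ->] /eqP ->] /forallP prop]|ncf] := ifPn.
  rewrite eqxx mulr1 [X in _ = X * _]big1 ?mul1r // => i _.
  by rewrite sub prop.
case: ifP => // Fl0; case: eqP => [Flm|_]; last by rewrite mulr0.
have [/forallP all1|] := boolP [forall i : 'I_n,
    is_subspace (Fl (inord i.+1)) && (Fl (inord i.+1) \proper Fl (inord i))].
  case/negP: ncf; rewrite /is_complete_flag Fl0 Flm eqxx !andbT.
  apply/andP; split; last by apply/forallP=> i; case/andP: (all1 i).
  apply/forallP=> j; case: (unliftP ord0 j) => [i|] ->.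
    have -> : lift ord0 i = inord i.+1 by apply: val_inj; rewrite /= inordK ?ltnS.
    by case/andP: (all1 i).
  rewrite (eqP Fl0); apply/andP; split; first by rewrite inE.
  by apply/forallP=> a; apply/forall_inP=> x _; apply/forall_inP=> y _; rewrite inE.
rewrite negb_forall => /existsP[i /negPf ei].
by rewrite (bigD1 i) //= ei !mul0r.
Qed.

Theorem mainTheorem7 (F : finFieldType) (n : nat) (lam : 'I_n -> nat)
  (hlam : forall i j : 'I_n, (i <= j)%N -> (lam j <= lam i)%N) :
  Slambda F lam =
  (-1) ^+ (\sum_(i < n) lam i)%N *
  \sum_(Fl : {ffun 'I_n.+1 -> {set 'rV[F]_n}} | is_complete_flag Fl)
     \prod_(i < n) pi_flag (F:=F) Fl i ^+ ((qq F ^ lam i - 1) %/ (qq F - 1))%N.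
Proof.
(* Extension by zero to all of [nat], the form in which the induction can shift the sequence. *)
pose lam1 k := if insub k is Some i then lam i else 0%N.
have lam1E (i : 'I_n) : lam1 i = lam i by rewrite /lam1 valK.
have free1 : row_free (1%:M : 'M[F]_n) by rewrite row_free_unit unitmx1.
have mooreE (mu : nat -> nat) (nu : 'I_n -> nat) :
    (forall i : 'I_n, nu i = (mu i + delta i)%N) ->
    Amoore F nu = moore F mu (row_emb (1%:M : 'M[F]_n)).
  move=> nuE; congr (\det _); apply/matrixP=> i j; rewrite !mxE nuE.
  congr (_ ^+ _); rewrite /row_emb row1 /emb (bigD1 i) //= big1 => [|l li].
    by rewrite addr0 !mxE !eqxx scale1r.
  by rewrite !mxE (negPf li) scale0r.
have setE : rowset (1%:M : 'M[F]_n) = [set: 'rV[F]_n].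
  by apply/setP=> w; rewrite in_setT; apply/imsetP; exists w; rewrite ?mulmx1.
have A0 : Amoore F (@delta n) != 0.
  by rewrite (mooreE (fun=> 0%N)) //; apply: moore_neq0 (indep_row_emb free1).
have := moore_flag_sum lam1 free1; rewrite setE -complete_flag_sum => mainE.
have eqA : ((-1) ^+ (\sum_(i < n) lam i)%N *
  \sum_(Fl : {ffun 'I_n.+1 -> {set 'rV[F]_n}} | is_complete_flag Fl)
     \prod_(i < n) pi_flag (F:=F) Fl i ^+ ((qq F ^ lam i - 1) %/ (qq F - 1))%N)
   * Amoore F (@delta n) = Amoore F (fun j => (lam j + delta j)%N).
  rewrite (mooreE (fun=> 0%N)) // (mooreE lam1) => [|i]; last by rewrite lam1E.
  rewrite mainE mulrC; congr (_ * (_ ^+ _ * _)).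
    by apply: eq_bigr => i _; rewrite lam1E.
  by apply: eq_bigr => Fl _; apply: eq_bigr => i _; rewrite lam1E.
(* [eqA] provides the witness that makes [epsilon] satisfy its equation; cancelling A_delta then
   identifies the two quotients. *)
apply: (mulIf A0); rewrite eqA.
exact: (ClassicalEpsilon.epsilon_spec _ (fun s => s * Amoore F (@delta n) =
  Amoore F (fun j => (lam j + delta j)%N)) (ex_intro _ _ eqA)).
Qed.
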